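(* Let $0\leq q < t$ be integers, and let $F$ be a forest with at most $t$ edges, consisting of $s$ rooted trees $T_1, \ldots, T_s$, such that for each $i\in[s]$ we have $1\leq e(T_i) < \frac{t-q}{3}$. Let $r_1,\ldots,r_s$ be the roots of the corresponding trees. Consider a partially colored complete graph $B$ with $V(B) = U\cup V$ (disjoint union), $|U|=s$, $|V|=t$, such that $B$ contains a collection of $s$ vertex-disjoint blue stars with centers $u_1, \ldots, u_s\in U$ and with total number of edges equal to $q\leq t$, while all other edges of $B[U,V]$ and all edges of $B[V]$ are free. Then, playing the Waiter-Client game on $B$, Waiter can force a red copy $\bar F$ of $F$ within at most $e(F)+1$ rounds in such a way that: (a) every root $r_i$ is mapped to $u_i$; (b) every colored edge of $B$ intersects $V(\bar F)$; (c) no edges connecting two vertices of $U$ are offered by Waiter; (d) every vertex not in $V(\bar F)$ is incident with at most one colored edge of $B$, and the other endpoint of such an edge is not a leaf of $\bar F$.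
   Context: Waiter-Client game on a board $B$ (a complete graph, possibly with some edges already colored): in each round Waiter offers Client two free (uncolored) edges of $B$; Client colors one of them red and the other becomes blue. Waiter ''forces a red copy of $F$ within $N$ rounds'' if she has a strategy guaranteeing that after at most $N$ rounds the red graph contains a copy of $F$ (given by an embedding of $F$ into the red graph). A rooted tree is a tree with one designated vertex called its root. A leaf of a rooted forest is a vertex of degree 1 which is not a root; leaves of the copy $\bar F$ are the images of leaves of $F$. $e(\cdot)$ denotes the number of edges, $[s]=\{1,\dots,s\}$, and $B[U,V]$, $B[V]$ denote the bipartite subgraph between $U$ and $V$ and the induced subgraph on $V$. *)

(* Defs.v *)
From mathcomp Require Import all_boot.
Set Implicit Arguments. Unset Strict Implicit. Unset Printing Implicit Defensive.

Section Graphs.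
Variable W : finType.

Definition adjE (E : {set {set W}}) : rel W :=
  fun x y => (x != y) && ([set x; y] \in E).

Definition edge_set (E : {set {set W}}) : Prop :=
  forall e, e \in E -> #|e| = 2.

Definition acyclic (E : {set {set W}}) : Prop :=
  forall x y, x != y -> [set x; y] \in E ->
    ~~ connect (adjE (E :\ [set x; y])) x y.

Definition comp (E : {set {set W}}) (w : W) : {set W} :=
  [set v | connect (adjE E) w v].

Definition comp_edges (E : {set {set W}}) (w : W) : {set {set W}} :=
  [set e in E | e \subset comp E w].

Definition rooted_forest (s : nat) (E : {set {set W}}) (r : 'I_s -> W) : Prop :=
  [/\ edge_set E, acyclic E,
      (forall w, exists i, connect (adjE E) (r i) w) &
      (forall i j, connect (adjE E) (r i) (r j) -> i = j)].

Definition forest_leaves (s : nat) (E : {set {set W}}) (r : 'I_s -> W) : {set W} :=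
  [set w | (#|[set v | adjE E w v]| == 1) && (w \notin [set r i | i : 'I_s])].

End Graphs.

Section WaiterClient.
Variable X : finType.

Definition free_edge (R Bl : {set {set X}}) (e : {set X}) : bool :=
  [&& #|e| == 2, e \notin R & e \notin Bl].

(* wc_force allowed Goal n R Bl : from the board (R, Bl), Waiter, offering only
   pairs of edges satisfying [allowed], can guarantee that within at most n
   rounds a board satisfying Goal is reached.  In one round Waiter offers two
   distinct free edges e1 e2; Client colours one red and the other blue. *)
Inductive wc_force (allowed : pred {set X})
    (Goal : {set {set X}} -> {set {set X}} -> Prop) :
    nat -> {set {set X}} -> {set {set X}} -> Prop :=
| wc_done n R Bl : Goal R Bl -> wc_force allowed Goal n R Bl
| wc_step n R Bl e1 e2 :
    free_edge R Bl e1 -> free_edge R Bl e2 -> e1 != e2 ->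
    allowed e1 -> allowed e2 ->
    wc_force allowed Goal n (e1 |: R) (e2 |: Bl) ->
    wc_force allowed Goal n (e2 |: R) (e1 |: Bl) ->
    wc_force allowed Goal n.+1 R Bl.

End WaiterClient.

Definition inU (s t : nat) (x : 'I_s + 'I_t) : bool :=
  if x is inl _ then true else false.

Definition not_in_U (s t : nat) (e : {set 'I_s + 'I_t}) : bool :=
  ~~ (e \subset [set x | inU x]).

Definition thm_goal (s t : nat) (W : finType) (E : {set {set W}}) (r : 'I_s -> W)
    (u : 'I_s -> 'I_s) (R Bl : {set {set 'I_s + 'I_t}}) : Prop :=
  exists phi : W -> 'I_s + 'I_t,
    [/\ injective phi,
        (forall e, e \in E -> phi @: e \in R),
        (forall i, phi (r i) = inl (u i)),
        (forall e, e \in R :|: Bl -> exists2 x, x \in e & x \in [set phi w | w : W]) &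
        (forall x, x \notin [set phi w | w : W] ->
           #|[set e in R :|: Bl | x \in e]| <= 1 /\
           (forall e y, e \in R :|: Bl -> x \in e -> y \in e -> y != x ->
              y \notin phi @: forest_leaves E r))].

(* Main.v *)
(* Waiter embeds the forest downwards from the roots, keeping every unused board
   vertex on at most one coloured edge; call it touched if there is one. Let m_i
   be the number of vertices of T_i still to be embedded, n the number of unused
   board vertices and q the number of touched ones. Offering x z and x z' with z,
   z' untouched embeds a child of a vertex x of her choice, but touches one vertex:
   n - q drops by 2. Offering x z and x' z with x, x' in two different trees touches
   nothing, but Client chooses which tree grows: n - q drops by 1, or by 0 if z was
   touched (from a third tree).
   With m_1 >= m_2 the two largest m_i, Waiter maintains
     3 m_1 + c <= n - q + 2   and   3 m_2 + c <= n - q + 1.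
   A move of the first kind in a strictly largest tree, one of the second kind on a
   touched vertex, and one of the second kind in two largest trees on an untouched
   vertex preserve this; the last fails only if three trees are tied and the bound is
   tight, when Waiter uses a touched vertex. She is stuck only if moreover q = 0.
   Then n = 3 m_1 + c - 1 is at least the sum of the m_i. If e(F) < t this is
   impossible for c = 1, and no round is wasted. If e(F) = t, the hypothesis allows
   c = 2, and when Waiter gets stuck the m_i are (m, m, m, 1). She then completes the
   small tree by a move of the first kind, which leaves the bounds with c = 0, for
   which she never gets stuck, together with a leaf g lying on no coloured edge but
   that to its parent p. When two slots remain, at x and y in distinct trees, with two
   untouched vertices, she wastes a round by offering x g and y g. Say x g becomes red.
   She fills the slot at y by a move of the first kind, and offers x z and p z for
   the last vertex z: if p z becomes red, z replaces g and g becomes the child of x. *)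
Require Import Defs.
From mathcomp Require Import all_boot zify.
Set Implicit Arguments. Unset Strict Implicit. Unset Printing Implicit Defensive.

Lemma adjE_sym (W : finType) (E : {set {set W}}) : symmetric (adjE E).
Proof. by move=> x y; rewrite /adjE eq_sym setUC. Qed.

(** * Parents in a rooted forest *)

Section Forest.
Context (s : nat) (W : finType) (E : {set {set W}}) (r : 'I_s -> W).
Context (rfE : rooted_forest E r).

Let adj := adjE E.

Lemma rooted_forest_rt :
  exists rt : W -> 'I_s, forall i w, connect adj (r i) w = (rt w == i).
Proof.
case: rfE => _ _ Hex Huniq.
have /fin_all_exists [rt Hrt] : forall w, exists i, connect adj (r i) w by exact: Hex.
exists rt => i w; apply/idP/eqP => [Hi|<-]; last exact: Hrt.
apply: Huniq; apply: (connect_trans (Hrt w)).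
by rewrite (sym_connect_sym (@adjE_sym _ E)).
Qed.

(** [dep w] is the length of a shortest walk from the root to [w]; the last but one vertex of that
    walk is a neighbour reached by a shorter walk. *)
Lemma rooted_forest_depth (rt : W -> 'I_s) :
  (forall i w, connect adj (r i) w = (rt w == i)) ->
  exists dep : W -> nat, forall w, w != r (rt w) ->
    exists2 v, adj v w & dep v < dep w.
Proof.
move=> Hrt.
pose walk w n := [exists p : n.-tuple W,
  path adj (r (rt w)) p && (last (r (rt w)) p == w)].
have walkP w p : path adj (r (rt w)) p -> last (r (rt w)) p = w -> walk w (size p).
  by move=> pth lst; apply/existsP; exists (in_tuple p); rewrite pth lst eqxx.
have Hex w : exists n, walk w n.
  have /connectP [p pth lst] : connect adj (r (rt w)) w by rewrite Hrt.
  by exists (size p); apply: walkP.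
exists (fun w => ex_minn (Hex w)) => w nrw.
case: (ex_minnP (Hex w)) => n /existsP [[p /= /eqP <-] /andP [pth /eqP lst]] _.
case/lastP: p pth lst => [|p x] /=; first by move=> _ rw; rewrite rw eqxx in nrw.
rewrite rcons_path last_rcons size_rcons => /andP [pth vadj] <-.
exists (last (r (rt w)) p) => //; set v := last _ p in vadj *.
case: ex_minnP => m _ /(_ (size p)); rewrite ltnS; apply.
have rtv : rt v = rt w by apply/eqP; rewrite -Hrt; apply/connectP; exists p.
by apply: walkP; rewrite rtv.
Qed.

(* An edge joining neither vertex to its parent could be deleted without
   disconnecting its ends, since both still reach the root through parents. *)
Lemma rooted_forest_parent :
  exists (rt : W -> 'I_s) (par : W -> W) (dep : W -> nat),
  [/\ forall i, rt (r i) = i,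
      forall w, w != r (rt w) -> rt (par w) = rt w /\ dep (par w) < dep w,
      E = [set [set par w; w] | w in [set w | w != r (rt w)]] &
      forall i, comp_edges E (r i) =
        [set [set par w; w] | w in [set w | (w != r (rt w)) && (rt w == i)]]].
Proof.
have [rt Hrt] := rooted_forest_rt; have [dep Hdep] := rooted_forest_depth Hrt.
have [Eset acE _ _] := rfE.
(* The default [w] occurs only at roots, since every other vertex has a neighbour of smaller
   depth. *)
pose par w := odflt w [pick v | adj v w && (dep v < dep w)].
have Hpar w : w != r (rt w) -> adj (par w) w /\ dep (par w) < dep w.
  move=> /Hdep [v av dv]; rewrite /par; case: pickP => [x /andP [] //|/(_ v)].
  by rewrite av dv.
have rt_adj v w : adj v w -> rt v = rt w.
  move=> avw; apply/esym/eqP; rewrite -Hrt.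
  by apply: (@connect_trans _ _ v); [rewrite Hrt | apply: connect1].
have Epar : E = [set [set par w; w] | w in [set w | w != r (rt w)]].
  apply/setP => e; apply/idP/imsetP => [Ee|[w]]; last first.
    by rewrite inE => /Hpar [/andP [_ ?] _] ->.
  have /eqP/cards2P [a [b [ab e_ab]]] := Eset e Ee.
  rewrite e_ab in Ee *.
  have [nba|/nandP nA] := boolP ((b != r (rt b)) && (par b == a)).
    by case/andP: nba => nb /eqP <-; exists b; rewrite ?inE.
  have [nba|/nandP nB] := boolP ((a != r (rt a)) && (par a == b)).
    by case/andP: nba => na /eqP <-; exists a; rewrite ?inE // setUC.
  have /negP[] := acE a b ab Ee.
  set e' := adjE _.
  have csym : connect_sym e' by apply/sym_connect_sym/adjE_sym.
  have up n w : dep w < n -> connect e' (r (rt w)) w.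
    elim: n w => // n IHn w dw.
    have [->|nw] := eqVneq w (r (rt w)).
      by rewrite (_ : rt (r (rt w)) = rt w) //; apply/eqP; rewrite -Hrt.
    have [aw dpw] := Hpar w nw.
    rewrite -(rt_adj _ _ aw); apply: connect_trans (IHn _ _) _.
      exact: leq_trans dpw _.
    (* A parent edge equal to [[set a; b]] would make [a] the parent of [b] or conversely, which
       [nA] and [nB] exclude. *)
    apply: connect1; case/andP: aw => pw Ew; rewrite /e' /adjE pw !inE Ew andbT /=.
    apply/eqP => abw.
    have : w \in [set a; b] by rewrite -abw !inE eqxx orbT.
    have : par w \in [set a; b] by rewrite -abw !inE eqxx.
    rewrite !inE => /orP [] /eqP Ep /orP [] /eqP wE.
    - by rewrite Ep wE eqxx in pw.
    - by case: nA => /negP[]; rewrite -wE -?Ep ?eqxx.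
    - by case: nB => /negP[]; rewrite -wE -?Ep ?eqxx.
    - by rewrite Ep wE eqxx in pw.
  rewrite csym.
  have rtab : rt a = rt b by apply: rt_adj; rewrite /adj /adjE ab.
  apply: (@connect_trans _ _ (r (rt a))).
    by rewrite csym rtab; apply: (up (dep b).+1).
  exact: (up (dep a).+1).
exists rt, par, dep; split=> //.
- by move=> i; apply/eqP; rewrite -Hrt.
- by move=> w nw; have [aw dw] := Hpar w nw; rewrite (rt_adj _ _ aw).
move=> i; apply/setP => e; rewrite inE {1}Epar; apply/andP/imsetP.
  case=> /imsetP [w]; rewrite inE => nw -> /subsetP /(_ w).
  rewrite !inE eqxx orbT Hrt => /(_ isT) /eqP <-.
  by exists w; rewrite // inE nw eqxx.
case=> w; rewrite inE => /andP [nw /eqP rw] ->; split.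
  by apply/imsetP; exists w; rewrite ?inE.
apply/subsetP => x; rewrite !inE Hrt => /orP [] /eqP -> //; last by rewrite rw.
by rewrite (rt_adj (par w) w) ?rw //; case: (Hpar w nw).
Qed.
End Forest.

(** * Partial embeddings *)

Lemma wc_forceW (X : finType) (allowed : pred {set X}) Goal n m R Bl :
  n <= m -> wc_force allowed Goal n R Bl -> wc_force allowed Goal m R Bl.
Proof.
move=> le_nm H; elim: H m le_nm => [{}n {}R {}Bl HG|{}n {}R {}Bl e1 e2 f1 f2 ne a1 a2 _ IH1 _ IH2] [|m] // le_nm.
- exact: wc_done.
- exact: wc_done.
- by apply: (wc_step f1 f2) => //; [apply: IH1 | apply: IH2].
Qed.

Section Embedding.
Context (s t : nat) (W : finType) (r : 'I_s -> W) (u : 'I_s -> 'I_s).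
Context (rt : W -> 'I_s) (par : W -> W) (dep : W -> nat).
Context (rtr : forall i, rt (r i) = i).
Context (parP : forall w, w != r (rt w) -> rt (par w) = rt w /\ dep (par w) < dep w).
Context (u_inj : injective u).

Local Notation X := ('I_s + 'I_t)%type.

Definition nonroot (w : W) := w != r (rt w).

Definition childless (w : W) :=
  nonroot w && [forall v, nonroot v ==> (par v != w)].

Lemma par_neq w : nonroot w -> par w != w.
Proof. by case/parP => _; apply: contraTneq => ->; rewrite ltnn. Qed.

Lemma par_not_childless w : nonroot w -> ~~ childless (par w).
Proof.
move=> nw; rewrite negb_and orbC; apply/orP; left.
by apply/forallPn; exists w; rewrite nw eqxx.
Qed.

Lemma childlessN w v : childless w -> nonroot v -> par v != w.
Proof. by case/andP => _ /forallP /(_ v) /implyP. Qed.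

Definition used (P : {set W}) (phi : W -> X) : {set X} := phi @: ~: P.

(* [P] is the set of vertices of the forest still to be embedded, [phi] matters
   only outside [P], and [tau x] is the vertex whose image is the other end of
   the unique coloured edge at the unused board vertex [x], if there is one.
   The vertices of [G] are leaves meeting no coloured edge but their own. *)
Record embedded (G P : {set W}) (phi : W -> X) (tau : X -> option W)
    (R Bl : {set {set X}}) : Prop := Embedded {
  emb_nonroot : forall w, w \in P -> nonroot w;
  emb_closed : forall w, nonroot w -> par w \in P -> w \in P;
  emb_inj : {in ~: P &, injective phi};
  emb_root : forall i, phi (r i) = inl (u i);
  emb_red : forall w, nonroot w -> w \notin P -> [set phi (par w); phi w] \in R;
  emb_touch : forall x e, x \notin used P phi -> e \in R :|: Bl -> x \in e ->
    exists v, [/\ tau x = Some v, v \notin P, ~~ childless v & e = [set phi v; x]];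
  emb_ne0 : forall e, e \in R :|: Bl -> e != set0;
  emb_good : forall g, g \in G -> [/\ g \notin P, childless g &
    forall e, e \in R :|: Bl -> phi g \in e -> e = [set phi (par g); phi g]] }.

Definition upd (A : eqType) (B : Type) (f : A -> B) (a : A) (b : B) : A -> B :=
  fun x => if x == a then b else f x.

Lemma upd_same (A : eqType) (B : Type) (f : A -> B) a b : upd f a b a = b.
Proof. by rewrite /upd eqxx. Qed.

Lemma upd_other (A : eqType) (B : Type) (f : A -> B) a b x :
  x != a -> upd f a b x = f x.
Proof. by rewrite /upd => /negbTE ->. Qed.

Lemma used_upd (P : {set W}) phi w z : w \in P ->
  used (P :\ w) (upd phi w z) = z |: used P phi.
Proof.
move=> Pw; rewrite /used; have -> : ~: (P :\ w) = w |: ~: P.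
  by apply/setP => v; rewrite !inE negb_and negbK.
rewrite imsetU1 upd_same; congr (_ |: _); apply: eq_in_imset => v.
rewrite inE => Pv; apply: upd_other; apply: contraNneq Pv => ->; exact: Pw.
Qed.

Lemma usedP (P : {set W}) phi w : w \notin P -> phi w \in used P phi.
Proof. by move=> Pw; apply: imset_f; rewrite inE. Qed.

(** * How newly coloured edges change a partial embedding *)

Section Moves.
Context (G P : {set W}) (phi : W -> X) (tau : X -> option W) (R Bl : {set {set X}}).
Context (emb : embedded G P phi tau R Bl).

Lemma emb_root_notin i : r i \notin P.
Proof. by apply/negP => /(emb_nonroot emb); rewrite /nonroot rtr eqxx. Qed.

Lemma emb_inU x : inU x -> x \in used P phi.
Proof.
case: x => // i _; have [v vK uK] := injF_bij u_inj.
by rewrite -(uK i) -(emb_root emb); apply: usedP (emb_root_notin _).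
Qed.

Lemma emb_nonroot_inU w : nonroot w -> w \notin P -> ~~ inU (phi w).
Proof.
move=> nw Pw; apply: contra nw => Uw.
case phw: (phi w) Uw => [i|//] _.
have [v vK uK] := injF_bij u_inj.
have Ew : w = r (v i).
  apply: (emb_inj emb); rewrite ?inE ?emb_root_notin //.
  by rewrite phw (emb_root emb) uK.
by rewrite Ew rtr.
Qed.

Lemma emb_parN w : nonroot w -> w \notin P -> par w \notin P.
Proof. by move=> nw; apply: contra; apply: emb_closed emb _ nw. Qed.

Lemma emb_neq v w : v \notin P -> w \notin P -> v != w -> phi v != phi w.
Proof.
by move=> Pv Pw; apply: contraNneq => E'; apply/eqP/(emb_inj emb); rewrite ?inE.
Qed.

Lemma emb_unused_neq v x : v \notin P -> x \notin used P phi -> phi v != x.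
Proof. by move=> Pv; apply: contraNneq => <-; apply: usedP. Qed.

Lemma emb_free v x : v \notin P -> x \notin used P phi -> tau x != Some v ->
  free_edge R Bl [set phi v; x].
Proof.
move=> Pv Ux tx; rewrite /free_edge cards2 emb_unused_neq //= -negb_or.
apply: contra tx => He.
have [|v' [-> Pv' _ E']] := emb_touch emb Ux (e := [set phi v; x]) _ (set22 _ _).
  by rewrite inE.
apply/eqP; congr Some; apply: (emb_inj emb); rewrite ?inE //.
have : phi v \in [set phi v'; x] by rewrite -E' set21.
by rewrite !inE (negbTE (emb_unused_neq Pv Ux)) orbF => /eqP.
Qed.

Lemma emb_allowed v x : x \notin used P phi -> not_in_U [set phi v; x].
Proof.
move=> Ux; apply/subsetPn; exists x; rewrite ?set22 // inE.
by apply: contra Ux; apply: emb_inU.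
Qed.

(** Once [z] is used, a coloured edge it carried before needs no entry in [tau]. If [z] was
    untouched, the new edge is the only coloured one at [z], so a childless [w] may join the good
    leaves. *)
Lemma emb_embed (G' : {set W}) w z :
  w \in P -> par w \notin P -> z \notin used P phi ->
  (forall g, g \in G' -> g \in G \/ [/\ g = w, childless w & tau z = None]) ->
  embedded G' (P :\ w) (upd phi w z) tau ([set phi (par w); z] |: R) Bl.
Proof.
move=> Pw Ppw Uz HG; have nw := emb_nonroot emb Pw.
have updN v : v \notin P -> upd phi w z v = phi v.
  by move=> Pv; apply: upd_other; apply: contraNneq Pv => ->.
have PN v : v \notin P :\ w -> v = w \/ v \notin P.
  by rewrite !inE negb_and negbK => /orP [/eqP|]; [left | right].
split.
- by move=> v /setD1P [_ /(emb_nonroot emb)].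
- move=> v nv; rewrite !inE => /andP [pvw Ppv].
  rewrite (emb_closed emb nv Ppv) andbT; apply: contraNneq Ppw => <-; exact: Ppv.
- move=> a b; rewrite !in_setC => /PN Ha /PN Hb.
  case: Ha Hb => [->|Pa] [->|Pb] //; rewrite ?upd_same ?updN //.
  + by move=> zb; case/negP: (emb_unused_neq Pb Uz); rewrite zb.
  + by move=> za; case/negP: (emb_unused_neq Pa Uz); rewrite za.
  + by apply: (emb_inj emb); rewrite inE.
- by move=> i; rewrite updN ?emb_root_notin // (emb_root emb).
- move=> v nv /PN [->|Pv]; first by rewrite upd_same updN // setU11.
  by rewrite !updN ?(emb_parN nv) // inE (emb_red emb) ?orbT.
- move=> x e; rewrite used_upd // in_setU1 => /norP [xz Ux].
  rewrite -setUA => /setU1P [->|Re xe].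
    rewrite !inE (negbTE xz) orbF => /eqP Ex.
    by case/negP: Ux; rewrite Ex usedP.
  have [v [tv Pv cv ->]] := emb_touch emb Ux Re xe.
  by exists v; split; rewrite ?updN // !inE negb_and Pv orbT.
- move=> e; rewrite -setUA => /setU1P [->|]; last exact: emb_ne0 emb _.
  by apply/set0Pn; exists z; rewrite set22.
- move=> g /HG [Gg|[-> cw tz]].
    have [Pg cg Hg] := emb_good emb Gg.
    have ngr : nonroot g by case/andP: cg.
    rewrite !updN ?(emb_parN ngr) //; split=> //; first by rewrite !inE negb_and Pg orbT.
    move=> e; rewrite -setUA => /setU1P [->|]; last exact: Hg.
    rewrite !inE (negbTE (emb_unused_neq Pg Uz)) orbF => /eqP Epg.
    have := childlessN cg nw; case/eqP; apply: (emb_inj emb); rewrite ?inE //.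
  rewrite upd_same updN //; split=> //; first by rewrite !inE eqxx.
  move=> e; rewrite -setUA => /setU1P [->//|Re ze].
  by have [v []] := emb_touch emb Uz Re ze; rewrite tz.
Qed.

(** As [v] is not childless, the new blue edge avoids the leaves, as (d) demands, and in particular
    the vertices of [G]. *)
Lemma emb_touch_blue v x : v \notin P -> ~~ childless v -> x \notin used P phi ->
  tau x = None ->
  embedded G P phi (upd tau x (Some v)) R ([set phi v; x] |: Bl).
Proof.
move=> Pv cv Ux tx; split; try by case: emb.
- move=> y e Uy; rewrite setUCA => /setU1P [->|Re].
    rewrite !inE => /orP [/eqP Ey|/eqP ->]; last by exists v; rewrite upd_same.
    by case/negP: Uy; rewrite Ey usedP.
  move=> ye; have [v' [tv' Pv' cv' Ee]] := emb_touch emb Uy Re ye.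
  exists v'; split=> //; rewrite upd_other //.
  by apply: contra_eq_neq tv' => ->; rewrite tx.
- move=> e; rewrite setUCA => /setU1P [->|]; last exact: emb_ne0 emb _.
  by apply/set0Pn; exists x; rewrite set22.
- move=> g Gg; have [Pg cg Hg] := emb_good emb Gg; split=> // e.
  rewrite setUCA => /setU1P [->|]; last exact: Hg.
  rewrite !inE (negbTE (emb_unused_neq Pg Ux)) orbF => /eqP Eg.
  by case/negP: cv; rewrite -((emb_inj emb) _ _ _ _ Eg) ?inE.
Qed.

Lemma emb_used_edges (R' B' : {set {set X}}) :
  (forall e, e \in R' :|: B' -> exists2 a, e = [set phi a.1; phi a.2] &
     [/\ a.1 \notin P, a.2 \notin P, a.1 \notin G & a.2 \notin G]) ->
  embedded G P phi tau (R' :|: R) (B' :|: Bl).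
Proof.
move=> H; have HU e : e \in (R' :|: R) :|: (B' :|: Bl) -> e \in R' :|: B' \/ e \in R :|: Bl.
  by rewrite setUACA inE => /orP [] ?; [left | right].
split; try by case: emb.
- by move=> w nw Pw; rewrite inE (emb_red emb) ?orbT.
- move=> x e Ux /HU [/H [[a b] /= -> [Pa Pb _ _]]|]; last exact: (emb_touch emb).
  rewrite !inE => /orP [] /eqP Ex; case/negP: Ux; rewrite Ex; exact: usedP.
- move=> e /HU [/H [a -> _]|]; last exact: (emb_ne0 emb).
  by apply/set0Pn; exists (phi a.1); rewrite set21.
move=> g Gg; have [Pg cg Hg] := emb_good emb Gg; split=> // e.
move=> /HU [/H [[a b] /= -> [Pa Pb Ga Gb]]|]; last exact: Hg.
rewrite !inE => /orP [] /eqP /(emb_inj emb); rewrite !inE => E'.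
  by rewrite -E' ?Gg in Ga.
by rewrite -E' ?Gg in Gb.
Qed.

Lemma emb_weaken (G' : {set W}) : G' \subset G -> embedded G' P phi tau R Bl.
Proof. by move/subsetP => sG; case: emb => *; split=> // g /sG; auto. Qed.

(* Hand the image of [g] over to the leaf [c], so that [g] becomes the missing leaf. *)
Lemma emb_swap g c : g \notin P -> childless g -> c \in P -> par c \notin P ->
  childless c -> [set phi (par c); phi g] \in R ->
  used (g |: P :\ c) (upd phi c (phi g)) = used P phi /\
  embedded set0 (g |: P :\ c) (upd phi c (phi g)) tau R Bl.
Proof.
move=> Pg cg Pc Ppc cc Rcg; have ng : nonroot g by case/andP: cg.
have nc := emb_nonroot emb Pc.
have cNg : c != g by apply: contraNneq Pg => <-.
have updN v : v \notin P -> upd phi c (phi g) v = phi v.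
  by move=> Pv; apply: upd_other; apply: contraNneq Pv => ->.
have PN v : v \notin g |: P :\ c -> v = c \/ v != g /\ v \notin P.
  rewrite !inE negb_or negb_and negbK => /andP [vg /orP [/eqP|]]; first by left.
  by right.
have notinE v : ~~ childless v -> v \notin P -> v \notin g |: P :\ c.
  move=> cv Pv; rewrite !inE negb_or negb_and Pv orbT andbT.
  by apply: contraNneq cv => ->.
have usedE : used (g |: P :\ c) (upd phi c (phi g)) = used P phi.
  rewrite /used; apply/setP => x; apply/imsetP/imsetP => [[v]|[v]]; rewrite in_setC.
    move=> /PN [->|[vg Pv]] ->; first by rewrite upd_same; exists g; rewrite ?inE.
    by rewrite updN //; exists v; rewrite ?inE.
  move=> Pv ->; have [->|vg] := eqVneq v g.
    by exists c; rewrite ?upd_same // !inE eqxx (negbTE cNg).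
  by exists v; rewrite ?updN // !inE negb_or negb_and vg Pv orbT.
split=> //; split.
- by move=> v /setU1P [->//|/setD1P [_ /(emb_nonroot emb)]].
- move=> v nv /setU1P [Epg|/setD1P [pvc Ppv]]; first by have := childlessN cg nv; rewrite Epg eqxx.
  have Pv := emb_closed emb nv Ppv; rewrite !inE Pv andbT.
  by rewrite (_ : v != c) ?orbT //; apply: contraNneq Ppc => <-.
- move=> a b; rewrite !in_setC => /PN Ha /PN Hb.
  case: Ha Hb => [->|[ga Pa]] [->|[gb Pb]] //; rewrite ?upd_same ?updN //.
  + by move=> /(emb_inj emb) E'; rewrite -E' ?inE ?eqxx // in gb.
  + by move=> /(emb_inj emb) E'; rewrite -E' ?inE ?eqxx // in ga.
  + by apply: (emb_inj emb); rewrite inE.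
- by move=> i; rewrite updN ?emb_root_notin // (emb_root emb).
- move=> v nv /PN [->|[gv Pv]]; first by rewrite upd_same updN.
  by rewrite !updN ?(emb_parN nv) // (emb_red emb).
- move=> x e; rewrite usedE => Ux Re xe.
  have [v [tv Pv cv ->]] := emb_touch emb Ux Re xe.
  by exists v; split; rewrite ?updN // notinE.
- exact: emb_ne0 emb.
- by move=> ?; rewrite inE.
Qed.

End Moves.

(** * Waiter's moves *)

Definition touched (P : {set W}) (phi : W -> X) (tau : X -> option W) : {set X} :=
  [set x | (x \notin used P phi) && (tau x != None)].

(** The balancing argument depends only on [G], [P] and the number [q] of touched vertices, so the
    embedding itself is hidden. *)
Definition state (G P : {set W}) (q : nat) (R Bl : {set {set X}}) : Prop :=
  exists phi tau, embedded G P phi tau R Bl /\ #|touched P phi tau| = q.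

(** This is the m_i of the strategy. *)
Definition pending (P : {set W}) (i : 'I_s) : nat := #|[set v in P | rt v == i]|.

Lemma pendingD1 (P : {set W}) w i : w \in P ->
  pending P i = (rt w == i) + pending (P :\ w) i.
Proof.
move=> Pw; rewrite /pending (cardsD1 w) !inE Pw /=; congr (_ + _).
by apply: eq_card => v; rewrite !inE andbA.
Qed.

Lemma sum_pending (P : {set W}) : \sum_i pending P i = #|P|.
Proof.
rewrite -sum1_card (partition_big rt xpredT) //=; apply: eq_bigr => i _.
by rewrite /pending -sum1_card; apply: eq_bigl => v; rewrite inE.
Qed.

(** A pending vertex of least depth in its tree has its parent embedded. *)
Lemma state_frontier G P q R Bl i : state G P q R Bl -> 0 < pending P i ->
  exists w, [/\ w \in P, par w \notin P & rt w = i].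
Proof.
case=> phi [tau [emb _]] /card_gt0P [v0]; rewrite inE => v0P.
case: (@arg_minnP _ v0 (fun v => (v \in P) && (rt v == i)) dep v0P) => w.
case/andP=> Pw /eqP rw wmin; exists w; split=> //.
have [rp dp] := parP (emb_nonroot emb Pw).
by apply: contraL dp => Pp; rewrite -leqNgt wmin // Pp rp rw eqxx.
Qed.

(* [ex] is [t - e(F)]. *)
Context (ex : nat) (exE : #|W| + ex = s + t).

Lemma card_unused G P phi tau R Bl : embedded G P phi tau R Bl ->
  #|~: used P phi| = #|P| + ex.
Proof.
move=> emb; have := cardsC (used P phi); rewrite card_in_imset; last exact: emb_inj emb.
by have := cardsC P; rewrite card_sum !card_ord; lia.
Qed.

Lemma not_used_upd (P : {set W}) phi w z x : w \in P ->
  (x \notin used (P :\ w) (upd phi w z)) = (x != z) && (x \notin used P phi).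
Proof. by move=> Pw; rewrite used_upd // in_setU1 negb_or. Qed.

Local Notation force := (wc_force (@not_in_U s t)).

(** Either answer embeds [w] at one of two untouched vertices and touches the other. The
    continuation receives [phi'] and [tau'] explicitly, because the last rounds must know which
    vertex was touched and from where. *)
Lemma force_same_parent Goal n (G G' P : {set W}) phi tau R Bl w :
  embedded G P phi tau R Bl -> w \in P -> par w \notin P ->
  #|touched P phi tau| + 2 <= #|P| + ex ->
  (forall g, g \in G' -> g \in G \/ g = w /\ childless w) ->
  (forall z z' (phi' := upd phi w z) (tau' := upd tau z' (Some (par w)))
     (R' := [set phi (par w); z] |: R) (Bl' := [set phi (par w); z'] |: Bl),
     z' \notin used (P :\ w) phi' ->
     #|touched (P :\ w) phi' tau'| = #|touched P phi tau|.+1 ->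
     embedded G' (P :\ w) phi' tau' R' Bl' -> force Goal n R' Bl') ->
  force Goal n.+1 R Bl.
Proof.
move=> emb Pw Ppw Hq HG IH.
have : 1 < #|~: used P phi :\: touched P phi tau|.
  rewrite cardsDS; first by rewrite (card_unused emb); lia.
  by apply/subsetP => x; rewrite !inE => /andP [].
case/card_gt1P => z [z' [Hz Hz' zz']].
have unt x : x \in ~: used P phi :\: touched P phi tau ->
    x \notin used P phi /\ tau x = None.
  by rewrite !inE => /andP [/nandP [/negPn ->|/negPn /eqP]].
have out x y : x \in ~: used P phi :\: touched P phi tau ->
    y \in ~: used P phi :\: touched P phi tau -> x != y ->
    force Goal n ([set phi (par w); x] |: R) ([set phi (par w); y] |: Bl).
  move=> /unt [Ux tx] /unt [Uy ty] xy.
  have HG' g : g \in G' -> g \in G \/ [/\ g = w, childless w & tau x = None].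
    by case/HG => [|[]]; [left | right].
  have emb1 := emb_embed emb Pw Ppw Ux HG'.
  have pw : par w != w by apply: par_neq; apply: emb_nonroot emb _ Pw.
  have Uy' : y \notin used (P :\ w) (upd phi w x).
    by rewrite not_used_upd // eq_sym xy.
  have := emb_touch_blue emb1 (v := par w) (x := y); rewrite upd_other //.
  move=> /(_ _ _ Uy' ty) emb2; apply: IH => //; last first.
    apply: emb2; first by rewrite !inE negb_and Ppw orbT.
    by apply: par_not_childless; apply: emb_nonroot emb _ Pw.
  rewrite -[_.+1]/(true + #|touched P phi tau|).
  have yT : y \notin touched P phi tau by rewrite !inE ty eqxx andbF.
  rewrite -yT -cardsU1; apply: eq_card => v; rewrite !inE not_used_upd // /upd.
  have [->|_] := eqVneq v y; first by rewrite eq_sym xy Uy.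
  by have [->|] := eqVneq v x; rewrite //= tx eqxx andbF.
have [Uz tz] := unt z Hz; have [Uz' tz'] := unt z' Hz'.
apply: (wc_step (e1 := [set phi (par w); z]) (e2 := [set phi (par w); z'])).
- by apply: emb_free emb _ _ Ppw Uz _; rewrite tz.
- by apply: emb_free emb _ _ Ppw Uz' _; rewrite tz'.
- apply: contra zz' => /eqP /setP /(_ z).
  by rewrite set22 !inE eq_sym (negbTE (emb_unused_neq Ppw Uz)) => /esym.
- exact: emb_allowed emb _ _ Uz.
- exact: emb_allowed emb _ _ Uz'.
- exact: out.
- by apply: out => //; rewrite eq_sym.
Qed.

Lemma force_two_untouched Goal n (G G' P : {set W}) q R Bl w :
  state G P q R Bl -> w \in P -> par w \notin P -> q + 2 <= #|P| + ex ->
  (forall g, g \in G' -> g \in G \/ g = w /\ childless w) ->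
  (forall R' Bl', state G' (P :\ w) q.+1 R' Bl' -> force Goal n R' Bl') ->
  force Goal n.+1 R Bl.
Proof.
case=> phi [tau [emb <-]] Pw Ppw Hq HG IH.
apply: (force_same_parent emb Pw Ppw Hq HG) => z z' phi' tau' R' Bl' _ tE emb'.
by apply: IH; exists phi', tau'.
Qed.

(** Whichever edge becomes red, [z] is then used, so the blue edge joins two used vertices and
    touches nothing. The subtracted boolean accounts for [z] having been touched before. *)
Lemma force_same_vertex Goal n (G P : {set W}) phi tau R Bl w1 w2 z :
  embedded G P phi tau R Bl -> w1 \in P -> par w1 \notin P ->
  w2 \in P -> par w2 \notin P -> par w1 != par w2 -> z \notin used P phi ->
  tau z != Some (par w1) -> tau z != Some (par w2) ->
  (forall w R' Bl', w = w1 \/ w = w2 ->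
     state G (P :\ w) (#|touched P phi tau| - (tau z != None)) R' Bl' ->
     force Goal n R' Bl') ->
  force Goal n.+1 R Bl.
Proof.
move=> emb Pw1 Pp1 Pw2 Pp2 p12 Uz tz1 tz2 IH.
have out w w' : w = w1 \/ w = w2 -> w' \in P -> w \in P -> par w' \notin P ->
    par w \notin P ->
    force Goal n ([set phi (par w); z] |: R) ([set phi (par w'); z] |: Bl).
  move=> Hw Pw' Pw Pp' Pp; apply: (IH w) => //.
  have nw' := emb_nonroot emb Pw'.
  exists (upd phi w z), tau; split; last first.
    have -> : touched (P :\ w) (upd phi w z) tau = touched P phi tau :\ z.
      by apply/setP => x; rewrite !inE not_used_upd // andbA.
    by rewrite [in RHS](cardsD1 z) !inE Uz /= addKn.
  have emb1 := emb_embed emb Pw Pp Uz (fun g Gg => or_introl Gg).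
  have embD v : v \notin P -> v \notin P :\ w by move=> Pv; rewrite !inE negb_and Pv orbT.
  have := @emb_used_edges _ _ _ _ _ _ emb1 set0 [set [set phi (par w'); z]].
  rewrite !set0U; apply=> e /set1P ->.
  exists (par w', w); first by rewrite /= upd_same upd_other //; apply: contraNneq Pp' => ->.
  split=> /=; first exact: embD.
  - by rewrite !inE eqxx.
  - apply: contra (par_not_childless nw') => Gp; by have [] := emb_good emb Gp.
  - by apply: contraL Pw => Gw; have [] := emb_good emb Gw.
apply: (wc_step (e1 := [set phi (par w1); z]) (e2 := [set phi (par w2); z])).
- exact: (emb_free emb).
- exact: (emb_free emb).
- apply/eqP => /setP /(_ (phi (par w1))); rewrite set21 !inE.
  by rewrite (negbTE (emb_neq emb Pp1 Pp2 p12)) (negbTE (emb_unused_neq Pp1 Uz)).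
- exact: emb_allowed emb _ _ Uz.
- exact: emb_allowed emb _ _ Uz.
- by apply: out => //; left.
- by apply: out => //; right.
Qed.

Lemma par_neq_rt w1 w2 : nonroot w1 -> nonroot w2 -> rt w1 != rt w2 -> par w1 != par w2.
Proof.
move=> /parP [<- _] /parP [<- _]; by apply: contra_neq => ->.
Qed.

Lemma force_untouched Goal n (G P : {set W}) q R Bl w1 w2 :
  state G P q R Bl -> w1 \in P -> par w1 \notin P ->
  w2 \in P -> par w2 \notin P -> rt w1 != rt w2 -> q < #|P| + ex ->
  (forall w R' Bl', w = w1 \/ w = w2 -> state G (P :\ w) q R' Bl' ->
     force Goal n R' Bl') ->
  force Goal n.+1 R Bl.
Proof.
case=> phi [tau [emb <-]] Pw1 Pp1 Pw2 Pp2 r12 Hq IH.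
have : 0 < #|~: used P phi :\: touched P phi tau|.
  rewrite cardsDS; first by rewrite (card_unused emb); lia.
  by apply/subsetP => x; rewrite !inE => /andP [].
case/card_gt0P => z; rewrite !inE => /andP [/nandP [/negPn Uz'|/negPn /eqP tz]] Uz.
  by rewrite Uz' in Uz.
apply: (force_same_vertex emb Pw1 Pp1 Pw2 Pp2 _ Uz); rewrite ?tz ?eqxx ?subn0 //.
by apply: par_neq_rt => //; apply: emb_nonroot emb _ _.
Qed.

(** [k] is the tree from which some touched vertex [z] was touched; the edges to [z] from embedded
    vertices of other trees are free. *)
Lemma force_touched Goal n (G P : {set W}) q R Bl :
  state G P q R Bl -> 0 < q ->
  exists k, forall w1 w2, w1 \in P -> par w1 \notin P ->
    w2 \in P -> par w2 \notin P -> rt w1 != rt w2 -> rt w1 != k -> rt w2 != k ->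
    (forall w R' Bl', w = w1 \/ w = w2 -> state G (P :\ w) q.-1 R' Bl' ->
       force Goal n R' Bl') ->
    force Goal n.+1 R Bl.
Proof.
case=> phi [tau [emb <-]] /card_gt0P [z]; rewrite inE => /andP [Uz].
case tz: (tau z) => [v|//] _; exists (rt v) => w1 w2 Pw1 Pp1 Pw2 Pp2 r12 r1 r2 IH.
have nw1 := emb_nonroot emb Pw1; have nw2 := emb_nonroot emb Pw2.
apply: (force_same_vertex emb Pw1 Pp1 Pw2 Pp2 _ Uz); rewrite ?tz /= ?subn1 //.
- exact: par_neq_rt.
- by apply: contra r1 => /eqP [->]; case: (parP nw1) => ->.
- by apply: contra r2 => /eqP [->]; case: (parP nw2) => ->.
Qed.

(** * The strategy *)

(* The bounds kept by Waiter, with slack [c]: [#|P| + ex] is the number n of unused vertices. *)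
Definition balanced (c : nat) (P : {set W}) (q : nat) : Prop :=
  (forall i, 3 * pending P i + c + q <= #|P| + ex + 2) /\
  (forall i j, i != j -> 3 * pending P i + c + q <= #|P| + ex + 1 \/
                         3 * pending P j + c + q <= #|P| + ex + 1).

Lemma pendingE (P : {set W}) w : w \in P ->
  #|P| = #|P :\ w|.+1 /\
  forall i, pending P i = if i == rt w then (pending (P :\ w) i).+1 else pending (P :\ w) i.
Proof.
move=> Pw; split; first by rewrite (cardsD1 w) Pw.
by move=> i; rewrite (pendingD1 i Pw) eq_sym; case: eqP.
Qed.

Lemma pending_gt0 (P : {set W}) : 0 < #|P| ->
  exists2 i, 0 < pending P i & forall j, pending P j <= pending P i.
Proof.
move=> P0; have [w Pw] : exists w, w \in P by apply/card_gt0P.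
case: (@arg_maxnP _ (rt w) xpredT (pending P) isT) => i _ imax.
exists i; last by move=> j; apply: imax.
by apply: leq_trans (imax (rt w) isT); apply/card_gt0P; exists w; rewrite inE Pw eqxx.
Qed.

Lemma pending_unique (P : {set W}) i : (forall j, j != i -> pending P j = 0) ->
  #|P| = pending P i.
Proof.
by move=> H; rewrite -sum_pending (bigD1 i) //= big1 ?addn0.
Qed.

Lemma force_step Goal n c (G P : {set W}) q R Bl :
  state G P q R Bl -> balanced c P q -> 0 < #|P| -> 0 < c \/ 2 < #|P| ->
  (forall (P' : {set W}) q' R' Bl', P' \subset P -> #|P'|.+1 = #|P| ->
     balanced c P' q' -> state G P' q' R' Bl' -> force Goal n R' Bl') ->
  force Goal n.+1 R Bl \/
  q = 0 /\ exists i1 i2 i3, [/\ i1 != i2, i1 != i3, i2 != i3 &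
    forall i, i \in [:: i1; i2; i3] -> 3 * pending P i + c = #|P| + ex + 1].
Proof.
move=> st [bal1 bal2] P0 cP IH.
have [i1 m0 imax] := pending_gt0 P0.
have IHw w q' R' Bl' : w \in P -> balanced c (P :\ w) q' ->
    state G (P :\ w) q' R' Bl' -> force Goal n R' Bl'.
  by move=> Pw; apply: IH; [exact: subD1set | case: (pendingE Pw)].
have [w1 [Pw1 Pp1 rw1]] := state_frontier st m0.
have [/existsP [i2 /andP [i21 /eqP m2]]|/existsPn tie] :=
    boolP [exists j, (j != i1) && (pending P j == pending P i1)]; last first.
  have {}tie j : j != i1 -> pending P j < pending P i1.
    by move=> ji; have := tie j; rewrite ji ltn_neqAle imax andbT.
  left; have b1 := bal1 i1.
  (* Either alternative makes the first bound yield two untouched vertices. If m_1 = 1 is strictly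
     largest, only one vertex is pending. *)
  have m2 : 0 < c \/ 1 < pending P i1.
    case: cP => [|P2]; [by left | right].
    rewrite ltnNge; apply/negP => m1; suff PE : #|P| = pending P i1 by lia.
    by apply: pending_unique => j /tie; lia.
  apply: (force_two_untouched st Pw1 Pp1 _ (G' := G)); first by case: m2; lia.
    by left.
  move=> R' Bl'; apply: IHw => //; have [cP1 pE] := pendingE Pw1.
  split=> [i|i j ij].
    by have := pE i; have := tie i; rewrite rw1; case: eqP => [->|_] /= H H'; [lia | have := H isT; lia].
  (* Every tree meets the tighter bound now: the threefold maximum drops by 3, [q] grows by 1 and n
     drops by 1. *)
  left; have := pE i; have := tie i; have b := bal1 i; rewrite rw1.
  have := pE i1; rewrite rw1 eqxx.
  case: (eqVneq i i1) => [->|_] /= H H'; [lia | move=> H''; have := H' isT; lia].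
have [w2 [Pw2 Pp2 rw2]] : exists w, [/\ w \in P, par w \notin P & rt w = i2].
  by apply: (state_frontier st); rewrite m2.
have b12 := bal2 _ _ i21.
have [/existsP [i3 /and4P [i31 i32 /eqP m3 /eqP tight]]|/existsPn third] :=
    boolP [exists j, [&& j != i1, j != i2, pending P j == pending P i1 &
      3 * pending P i1 + c + q == #|P| + ex + 1]]; last first.
  left; apply: (force_untouched st Pw1 Pp1 Pw2 Pp2 _).
  - by rewrite rw1 rw2 eq_sym.
  - by have := bal1 i1; lia.
  have key i j : j \in P -> 3 * pending (P :\ j) i + c + q <= #|P :\ j| + ex + 2.
    move=> Pj; have [cPj pE] := pendingE Pj; have := pE i; have := imax i; case: eqP; lia.
  have lo j : j != i1 -> j != i2 -> 3 * pending P j + c + q <= #|P| + ex.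
    move=> j1 j2; have := third j; rewrite j1 j2 /= negb_and; have := imax j.
    by move: b12; rewrite m2; clear; move=> ? ? /orP []; lia.
  move=> w R' Bl' Hw; have Pw : w \in P by case: Hw => ->.
  have rw : rt w = i1 \/ rt w = i2 by case: Hw => ->; [left | right].
  apply: IHw => //; have [cPw pE] := pendingE Pw; split=> [i|i j ij]; first exact: key.
  (* Only the tied tree that Client did not extend can violate the tighter bound, so of two trees at
     least one meets it. *)
  have {}lo k : k == rt w \/ (k != i1 /\ k != i2) ->
      3 * pending (P :\ w) k + c + q <= #|P :\ w| + ex + 1.
    have := pE k; move: (imax k) b12; rewrite m2 cPw; case: eqVneq => [_|_ +++ [//|[k1 k2]]].
      by clear; lia.
    by move: (lo k k1 k2); rewrite cPw; clear; lia.
  have [iw|niw] := boolP ((i == rt w) || ((i != i1) && (i != i2))).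
    by left; apply: lo; case/orP: iw => [|/andP [] ]; [left | right].
  right; apply: lo; move: niw; rewrite negb_or negb_and !negbK.
  case: rw => -> /andP [nw /orP [] /eqP Ei]; move: nw ij; rewrite Ei ?eqxx // => _ ij.
    by have [_|_] := eqVneq j i1; [left | right; rewrite eq_sym].
  by have [_|_] := eqVneq j i2; [left | right; rewrite eq_sym].
have [q0|q0] := posnP q.
  right; split=> //; exists i1, i2, i3; split; rewrite 1?eq_sym //.
  by move=> i; rewrite !inE => /or3P [] /eqP ->; rewrite ?m2 ?m3 -tight q0 addn0.
left.
have [w3 [Pw3 Pp3 rw3]] : exists w, [/\ w \in P, par w \notin P & rt w = i3].
  by apply: (state_frontier st); rewrite m3.
(* At least two of the three tied trees differ from [k]; extending either of them keeps n - q
   unchanged. *)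
have [k Hk] := force_touched Goal n st q0.
have fin w w' : w \in P -> par w \notin P -> w' \in P -> par w' \notin P ->
    rt w != rt w' -> rt w != k -> rt w' != k -> force Goal n.+1 R Bl.
  move=> Pw Pp Pw' Pp' rww rwk rwk'; apply: (Hk w w') => // x R' Bl' Hx.
  have Px : x \in P by case: Hx => ->.
  have [cPx pE] := pendingE Px.
  have le l : pending (P :\ x) l <= pending P l by rewrite (pE l); case: eqP.
  apply: IHw => //; split=> [i|i j ij].
    by move: (le i) (bal1 i); rewrite cPx; clear -q0; lia.
  by move: (le i) (le j) (bal2 _ _ ij); rewrite cPx; clear -q0; lia.
have [k1|nk1] := eqVneq i1 k.
  by apply: (fin w2 w3); rewrite ?rw2 ?rw3 -?k1 // eq_sym.
have [k2|nk2] := eqVneq i2 k.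
  by apply: (fin w1 w3); rewrite ?rw1 ?rw3 -?k2 // eq_sym.
by apply: (fin w1 w2); rewrite ?rw1 ?rw2 // eq_sym.
Qed.

Lemma card_pending3 (P : {set W}) i1 i2 i3 : i1 != i2 -> i1 != i3 -> i2 != i3 ->
  #|P| = pending P i1 + pending P i2 + pending P i3 +
         \sum_(i | [&& i != i1, i != i2 & i != i3]) pending P i.
Proof.
move=> n12 n13 n23.
rewrite -sum_pending (bigD1 i1) //= (bigD1 i2) ?(eq_sym i2) //= (bigD1 i3) /=; last first.
  by rewrite !(eq_sym i3) n13.
by rewrite !addnA; congr (_ + _); apply: eq_bigl => i; rewrite andbA.
Qed.

(** * The end of the game *)

Section Endgame.
Context (Goal : {set {set X}} -> {set {set X}} -> Prop).
Context (goalP : forall G phi tau R Bl, embedded G set0 phi tau R Bl -> Goal R Bl).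

(** If the edge at [par c] becomes red, [c] goes to [z]. Otherwise [c] takes over the image of [g]
    through the red edge already present, and [g] goes to [z]. *)
Lemma force_last_leaf P phi tau R Bl g c z :
  embedded set0 P phi tau R Bl -> P = [set c] -> par c \notin P -> childless c ->
  g \notin P -> childless g -> [set phi (par c); phi g] \in R ->
  z \notin used P phi -> par c != par g ->
  tau z != Some (par c) -> tau z != Some (par g) ->
  force Goal 1 R Bl.
Proof.
move=> emb PE Ppc cc Pg cg Rcg Uz pcg tc tg.
have Pc : c \in P by rewrite PE set11.
have ng : nonroot g by case/andP: cg.
have Ppg := emb_parN emb ng Pg.
have P0 : P :\ c = set0 by rewrite PE setDv.
apply: (wc_step (e1 := [set phi (par c); z]) (e2 := [set phi (par g); z])).
- exact: (emb_free emb).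
- exact: (emb_free emb).
- apply/eqP => /setP /(_ (phi (par c))); rewrite set21 !inE.
  by rewrite (negbTE (emb_neq emb Ppc Ppg pcg)) (negbTE (emb_unused_neq Ppc Uz)).
- exact: emb_allowed emb _ _ Uz.
- exact: emb_allowed emb _ _ Uz.
- apply: wc_done; have emb1 := emb_embed emb (G' := set0) Pc Ppc Uz.
  have {}emb1 := emb1 (fun g h => or_introl h); rewrite P0 in emb1.
  have := @emb_used_edges _ _ _ _ _ _ emb1 set0 [set [set phi (par g); z]].
  rewrite !set0U => emb2; apply: goalP; apply: emb2 => e /set1P ->.
  exists (par g, c); rewrite ?inE //= upd_same upd_other //.
  by apply: contraNneq Ppg => ->.
apply: wc_done.
have [UE emb1] := emb_swap emb Pg cg Pc Ppc cc Rcg.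
rewrite P0 setU0 in UE emb1; rewrite -UE in Uz.
have pgg : par g != g := par_neq ng.
have pcg' : par c != g := childlessN cg (emb_nonroot emb Pc).
have cpg : par g != c by apply: contraNneq Ppg => ->.
have pcc : par c != c by apply: contraNneq Ppc => ->.
have emb2 := emb_embed emb1 (G' := set0) (set11 g) _ Uz.
have {}emb2 := emb2 _ (fun g h => or_introl h); rewrite inE pgg setDv in emb2.
have {}emb2 := emb2 isT; rewrite upd_other // in emb2.
have := @emb_used_edges _ _ _ _ _ _ emb2 set0 [set [set phi (par c); z]].
rewrite !set0U => emb3; apply: goalP; apply: emb3 => e /set1P ->.
by exists (par c, g); rewrite ?inE //= upd_same !upd_other.
Qed.

(** The wasted edges meet [g], so the set of good leaves is emptied first. Embedding [c2] touches
    the last vertex from [par c2], which differs from [par c1] and [par g], so both edges of the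
    last round are free. *)
Lemma force_last_two (G P : {set W}) phi tau R Bl g c1 c2 :
  embedded G P phi tau R Bl -> ex = 0 -> #|touched P phi tau| = 0 -> #|P| = 2 ->
  c1 \in P -> par c1 \notin P -> childless c1 -> c2 \in P -> par c2 \notin P ->
  c1 != c2 -> par c1 != par c2 -> g \in G -> par c1 != par g -> par c2 != par g ->
  force Goal 2 ([set phi (par c1); phi g] |: R) ([set phi (par c2); phi g] |: Bl).
Proof.
move=> emb ex0 T0 P2 Pc1 Pp1 cc1 Pc2 Pp2 c12 p12 Gg p1g p2g.
have [Pg cg _] := emb_good emb Gg.
have emb0 := emb_weaken emb (sub0set G).
have emb1 : embedded set0 P phi tau ([set phi (par c1); phi g] |: R)
    ([set phi (par c2); phi g] |: Bl).
  apply: (emb_used_edges emb0) => e.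
  by case/setUP => /set1P ->; [exists (par c1, g) | exists (par c2, g)]; rewrite ?inE.
apply: (force_same_parent emb1 Pc2 Pp2 (G' := set0)); first by rewrite T0 P2.
  by move=> ?; rewrite inE.
move=> z z' phi' tau' R' Bl' Uz' _ emb2.
have PD v : v \notin P -> v \notin P :\ c2 by move=> Pv; rewrite !inE negb_and Pv orbT.
have phiE v : v \notin P -> phi' v = phi v.
  by move=> Pv; apply: upd_other; apply: contraNneq Pv => ->.
apply: (force_last_leaf (g := g) (c := c1) (z := z') emb2) => //; rewrite ?PD ?phiE //.
- apply/eqP; rewrite eq_sym eqEcard sub1set !inE c12 Pc1 cards1.
  by have [] := pendingE Pc2; rewrite P2 => -[<-].
- by rewrite !inE eqxx orbT.
- by rewrite /tau' upd_same; apply: contra p12 => /eqP [->].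
- by rewrite /tau' upd_same; apply: contra p2g => /eqP [->].
Qed.

Lemma force_end (G P : {set W}) R Bl g :
  ex = 0 -> state G P 0 R Bl -> #|P| = 2 -> balanced 0 P 0 ->
  g \in G -> pending P (rt g) = 0 -> force Goal 3 R Bl.
Proof.
move=> ex0 st P2 [bal _] Gg pg0.
(* With n = 2 and [q = 0] the first bound reads 3 m_i <= 4, so the two slots lie in distinct trees,
   and [g] in a third, finished one. *)
have le1 i : pending P i <= 1 by have := bal i; rewrite P2 ex0; lia.
have /card_gt1P [v1 [v2 [Pv1 Pv2 v12]]] : 1 < #|P| by rewrite P2.
have pos v : v \in P -> 0 < pending P (rt v).
  by move=> Pv; apply/card_gt0P; exists v; rewrite inE Pv eqxx.
have uniq v w : v \in P -> w \in P -> rt v = rt w -> v = w.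
  move=> Pv Pw vw; have := le1 (rt w); rewrite /pending => /card_le1_eqP; apply.
    by rewrite inE Pw eqxx.
  by rewrite inE Pv vw eqxx.
have frontier v : v \in P -> par v \notin P.
  move=> Pv; have [w [Pw Pp rw]] := state_frontier st (pos v Pv).
  by rewrite -(uniq w v).
case: st => phi [tau [emb T0]].
have nr v : v \in P -> nonroot v := @emb_nonroot _ _ _ _ _ _ emb v.
have ccl v : v \in P -> childless v.
  move=> Pv; rewrite /childless nr //=; apply/forallP => w; apply/implyP => nw.
  apply/eqP => pw; have Pw : w \in P by apply: emb_closed emb _ nw _; rewrite pw.
  by have := frontier w Pw; rewrite pw Pv.
have [Pg cg Hg] := emb_good emb Gg; have ng : nonroot g by case/andP: cg.
have pP v : v \in P -> par v != par g.
  move=> Pv; apply: par_neq_rt => //; first exact: nr.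
  by apply/eqP => rvg; have := pos v Pv; rewrite rvg pg0.
have p12 : par v1 != par v2.
  by apply: par_neq_rt; rewrite ?nr //; apply: contra v12 => /eqP /uniq ->.
have pgN v : v \in P -> phi (par v) != phi g.
  by move=> Pv; apply: (emb_neq emb); rewrite ?frontier // childlessN ?nr.
have free v : v \in P -> free_edge R Bl [set phi (par v); phi g].
  move=> Pv; rewrite /free_edge cards2 pgN //= -negb_or.
  apply/negP => He; have : [set phi (par v); phi g] = [set phi (par g); phi g].
    by apply: Hg; rewrite ?inE ?eqxx ?orbT.
  move/setP/(_ (phi (par v))); rewrite set21 !inE (negbTE (pgN v Pv)) orbF.
  by rewrite (negbTE (emb_neq emb (frontier v Pv) (emb_parN emb ng Pg) (pP v Pv))).
have allowed v : not_in_U [set phi v; phi g].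
  by apply/subsetPn; exists (phi g); rewrite ?set22 // inE (emb_nonroot_inU emb).
apply: (wc_step (e1 := [set phi (par v1); phi g]) (e2 := [set phi (par v2); phi g])).
- exact: free.
- exact: free.
- apply/eqP => /setP /(_ (phi (par v1))); rewrite set21 !inE (negbTE (pgN v1 Pv1)).
  by rewrite (negbTE (emb_neq emb (frontier v1 Pv1) (frontier v2 Pv2) p12)).
- exact: allowed.
- exact: allowed.
- by apply: (force_last_two emb ex0 T0 P2); rewrite ?frontier ?ccl ?pP.
- by apply: (force_last_two emb ex0 T0 P2); rewrite ?frontier ?ccl ?pP // eq_sym.
Qed.

Lemma force_spare G P q R Bl : 0 < ex -> state G P q R Bl -> balanced 1 P q ->
  force Goal #|P| R Bl.
Proof.
move=> ex0; move eqk: #|P| => k.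
elim: k P q R Bl eqk => [|k IH] P q R Bl Pk st bal.
  case: st => phi [tau [emb _]]; apply: wc_done; apply: (goalP (G := G) (phi := phi) (tau := tau)).
  by rewrite (cards0_eq Pk) in emb.
have P0 : 0 < #|P| by rewrite Pk.
case: (@force_step Goal k 1 G P q R Bl st bal P0 (or_introl isT)) => // [P' q' R' Bl' _ cP bal' st'|].
  by apply: (IH P' q' R' Bl' _ st' bal'); lia.
case=> _ [i1 [i2 [i3 [n12 n13 n23 H]]]].
(* The three tied trees would contain [#|P| + ex] pending vertices, more than there are. *)
have := card_pending3 P n12 n13 n23.
have := H i1; have := H i2; have := H i3.
by rewrite !inE !eqxx !orbT => /(_ isT) ? /(_ isT) ? /(_ isT); lia.
Qed.

Lemma force_good G P q R Bl g : ex = 0 -> state G P q R Bl -> balanced 0 P q ->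
  g \in G -> pending P (rt g) = 0 -> 1 < #|P| -> force Goal #|P|.+1 R Bl.
Proof.
move=> ex0; move eqk: #|P| => k.
elim: k P q R Bl eqk => [|k IH] P q R Bl Pk st bal Gg pg0 // k1.
have P0 : 0 < #|P| by rewrite Pk.
have [k2|k2] := eqVneq k 1.
  (* Two pending vertices in one tree violate the first bound; in two trees the second bound forces
     [q = 0]. *)
  rewrite k2 in Pk *; suff q0 : q = 0 by rewrite q0 in st bal; apply: force_end Gg pg0.
  have [i ip imax] := pending_gt0 P0; case: (bal) => /(_ i) bal1 bal2.
  have [/existsP [j /andP [ji jp]]|/existsPn H] := boolP [exists j, (j != i) && (0 < pending P j)].
    by have := bal2 _ _ ji; lia.
  suff : #|P| = pending P i by lia.
  by apply: pending_unique => j ji; have := H j; rewrite ji; case: pending.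
case: (@force_step Goal k.+1 0 G P q R Bl st bal P0) => // [|P' q' R' Bl' sP cP bal' st'|].
- by right; lia.
- apply: (IH P' q' R' Bl' _ st' bal' Gg); [by lia | | by lia].
  by apply/eqP; rewrite -leqn0 -pg0 subset_leq_card //; apply/subsetP => v; rewrite !inE
    => /andP [/(subsetP sP) -> ->].
case=> _ [i1 [i2 [i3 [n12 n13 n23 H]]]].
(* Here the three trees would contain [#|P| + 1] pending vertices. *)
have := card_pending3 P n12 n13 n23.
have := H i1; have := H i2; have := H i3.
by rewrite !inE !eqxx !orbT => /(_ isT) ? /(_ isT) ? /(_ isT); lia.
Qed.

Lemma force_spanning G P q R Bl : ex = 0 -> state G P q R Bl -> balanced 2 P q ->
  force Goal #|P|.+1 R Bl.
Proof.
move=> ex0; move eqk: #|P| => k.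
elim: k P q R Bl eqk => [|k IH] P q R Bl Pk st bal.
  case: st => phi [tau [emb _]]; apply: wc_done; apply: (goalP (G := G) (phi := phi) (tau := tau)).
  by rewrite (cards0_eq Pk) in emb.
have P0 : 0 < #|P| by rewrite Pk.
case: (@force_step Goal k.+1 2 G P q R Bl st bal P0 (or_introl isT)) => // [P' q' R' Bl' _ cP bal' st'|].
  by apply: (IH P' q' R' Bl' _ st' bal'); lia.
case=> q0 [i1 [i2 [i3 [n12 n13 n23 H]]]].
have := card_pending3 P n12 n13 n23; set rest := \sum_(i | _) _ => sumP.
have := H i1; have := H i2; have := H i3.
rewrite !inE !eqxx !orbT => /(_ isT) H3 /(_ isT) H2 /(_ isT) H1.
(* The three tied trees contain all but one of the pending vertices. *)
have rest1 : rest = 1 by lia.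
have [i /and3P [ni1 ni2 ni3] ip] : exists2 i, [&& i != i1, i != i2 & i != i3] & 0 < pending P i.
  apply/exists_inP; apply: contraT => /exists_inPn H0.
  by move: rest1; rewrite /rest big1 // => i /H0; rewrite -eqn0Ngt => /eqP.
have le1 j : [&& j != i1, j != i2 & j != i3] -> pending P j <= 1.
  by move=> Hj; rewrite -rest1 /rest (bigD1 j) //= leq_addr.
have pi1 : pending P i = 1 by have := le1 i; rewrite ni1 ni2 ni3 => /(_ isT); lia.
have P4 : 3 < #|P| by have := (proj1 bal) i; lia.
have [w [Pw Pp rw]] := state_frontier st ip.
have [cPw pE] := pendingE Pw.
apply: (force_two_untouched st Pw Pp (G' := [set w])).
  by clear -P4 q0; lia.
  (* A child of [w] would be pending too, but the tree of [w] has only one pending vertex. *)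
  move=> g /set1P ->; right; split=> //.
  case: st => phi [tau [emb _]]; have nw := emb_nonroot emb Pw.
  rewrite /childless nw; apply/forallP => v; apply/implyP => nv; apply/eqP => pv.
  have Pv : v \in P by apply: emb_closed emb _ nv _; rewrite pv.
  have vw : v != w by rewrite -pv eq_sym par_neq.
  have : 0 < pending (P :\ w) i.
    by apply/card_gt0P; exists v; rewrite !inE vw Pv -rw -pv; case: (parP nv) => -> _ /=.
  by move: pi1; rewrite (pE i) rw eqxx => -[->].
move=> R' Bl' st'.
(* This is the tighter bound for [c = 0] after the move, when [q] is 1 and n is [#|P| - 1]. *)
have bnd j : 3 * pending (P :\ w) j + 1 <= #|P|.
  have : pending (P :\ w) j <= pending P j by rewrite (pE j); case: eqP.
  have [->|j1] := eqVneq j i1; first by clear -H1 ex0; lia.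
  have [->|j2] := eqVneq j i2; first by clear -H2 ex0; lia.
  have [->|j3] := eqVneq j i3; first by clear -H3 ex0; lia.
  by move: (le1 j); rewrite j1 j2 j3 => /(_ isT); clear -P4; lia.
have := @force_good _ _ _ _ _ w ex0 st'.
rewrite -Pk cPw; apply; rewrite ?set11 //.
- by split=> [j|j j' _]; [|left]; move: (bnd j); rewrite cPw q0; clear -ex0; lia.
- by move: pi1; rewrite (pE i) rw eqxx => -[].
- by move: P4; rewrite cPw; apply: ltnW.
Qed.
End Endgame.
End Embedding.

(** * The initial position and the final embedding *)

Theorem theorem3p19
  (q t s : nat) (W : finType) (E : {set {set W}}) (r : 'I_s -> W)
  (u : 'I_s -> 'I_s) (L : 'I_s -> {set 'I_t})
  (R0 B0 : {set {set 'I_s + 'I_t}}) :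
  q < t ->
  (* F is a forest of s rooted trees T_i with roots r_i *)
  rooted_forest E r ->
  #|E| <= t ->
  (forall i, 1 <= #|comp_edges E (r i)| /\ 3 * #|comp_edges E (r i)| < t - q) ->
  (* B: partially coloured complete graph on U + V; the coloured edges form
     a red set R0 and a disjoint blue set B0 of 2-subsets *)
  edge_set R0 -> edge_set B0 -> [disjoint R0 & B0] ->
  (* blue stars with distinct centres u_i in U, pairwise disjoint leaf sets
     L_i in V, q edges in total *)
  injective u ->
  (forall i j, i != j -> [disjoint L i & L j]) ->
  \sum_(i < s) #|L i| = q ->
  (* edges of B[U,V]: blue iff a star edge, otherwise free *)
  (forall i v, [set inl (u i); inr v] \notin R0) ->
  (forall i v, ([set inl (u i); inr v] \in B0) = (v \in L i)) ->
  (* edges of B[V]: all free *)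
  (forall v w, [set inr v; inr w] \notin R0 :|: B0) ->
  wc_force (@not_in_U s t) (thm_goal E r u) (#|E|).+1 R0 B0.
Proof.
move=> _ rfE Et size_tree R2 B2 _ u_inj Ldisj Lq UVred UVblue VV.
have [rt [par [dep [rtr parP EE compE]]]] := rooted_forest_parent rfE.
have r_inj : injective r := can_inj rtr.
pose P0 := [set w | nonroot r rt w].
(* Two vertices with the same parent edge would be parents of each other, against the decrease of
   depth. *)
have parE_inj : {in P0 &, injective (fun w => [set par w; w])}.
  move=> v w; rewrite !inE => nv nw vw; apply/eqP/negPn/negP => Nvw.
  have : v \in [set par w; w] by rewrite -vw set22.
  have : w \in [set par v; v] by rewrite vw set22.
  rewrite !inE (eq_sym w v) (negbTE Nvw) !orbF => /eqP wv /eqP vw'.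
  have [_] := parP v nv; have [_] := parP w nw.
  by rewrite -wv -vw' => h1 h2; have := ltn_trans h1 h2; rewrite ltnn.
have cardE : #|E| = #|P0| by rewrite EE card_in_imset.
have pendE i : pending rt P0 i = #|comp_edges E (r i)|.
  rewrite compE card_in_imset; first by apply: eq_card => w; rewrite !inE.
  by move=> v w; rewrite !inE => /andP [nv _] /andP [nw _]; apply: parE_inj; rewrite inE.
have rootP w : w \notin P0 -> w = r (rt w) by rewrite inE negbK => /eqP.
have cardW : #|W| + (t - #|E|) = s + t.
  have -> : #|W| = s + #|E|; last by lia.
  rewrite -(cardsC P0) cardE addnC; congr (_ + _).
  rewrite -[s in RHS]card_ord -(card_imset _ r_inj); apply: eq_card => w.
  rewrite inE; apply/idP/imsetP => [/rootP wr|[i _ ->]]; first by exists (rt w).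
  by rewrite inE /nonroot rtr eqxx.
(* The only neighbour of a leaf is its parent, so a child would coincide with the parent, again
   against depth. *)
have leafP v : v \in forest_leaves E r -> childless r rt par v.
  rewrite inE => /andP [/cards1P [x Ex] nrv].
  have nv : nonroot r rt v by apply: contra nrv => /eqP ->; apply: imset_f.
  have adjP w : nonroot r rt w -> adjE E w (par w).
    move=> nw; rewrite /adjE eq_sym (par_neq parP) //= EE; apply/imsetP.
    by exists w; rewrite ?inE // setUC.
  have xE w : adjE E v w -> w = x.
    by move=> vw; apply/set1P; rewrite -Ex inE.
  rewrite /childless nv; apply/forallP => w; apply/implyP => nw; apply/eqP => pw.
  have wx : w = x by apply: xE; rewrite adjE_sym -pw adjP.
  have pvx := xE _ (adjP v nv).
  have [_] := parP v nv; have [_] := parP w nw.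
  by rewrite pw pvx -wx => h1 h2; have := ltn_trans h1 h2; rewrite ltnn.
have goalP G (phi : W -> 'I_s + 'I_t) tau R Bl : embedded r u rt par G set0 phi tau R Bl -> thm_goal E r u R Bl.
  move=> emb; exists phi.
  have phi_inj : injective phi by move=> v w; apply: (emb_inj emb); rewrite !inE.
  have UE : [set phi w | w : W] = used set0 phi.
    by apply/setP => x; apply/imsetP/imsetP => -[w _ ->]; exists w; rewrite ?inE.
  rewrite UE; split=> //.
  - move=> e; rewrite EE => /imsetP [w]; rewrite inE => nw ->.
    by rewrite imsetU1 imset_set1; apply: (emb_red emb); rewrite ?inE.
  - exact: emb_root emb.
  - move=> e Re; have /set0Pn [x xe] := emb_ne0 emb Re.
    have [Ux|Ux] := boolP (x \in used set0 phi); first by exists x.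
    have [v [_ Pv _ ->]] := emb_touch emb Ux Re xe.
    by exists (phi v); rewrite ?set21 ?usedP.
  - move=> x Ux; split.
      apply/card_le1_eqP => e e'; rewrite !inE -!in_setU => /andP [Re xe] /andP [Re' xe'].
      have [v [tv _ _ ->]] := emb_touch emb Ux Re xe.
      by have [v' [tv' _ _ ->]] := emb_touch emb Ux Re' xe'; move: tv'; rewrite tv => -[->].
    move=> e y Re xe ye yx; have [v [_ _ cv Ee]] := emb_touch emb Ux Re xe.
    move: ye; rewrite Ee !inE (negbTE yx) orbF => /eqP ->.
    by apply: contra cv => /imsetP [w /leafP cw /phi_inj ->].
(* Only the roots lie outside [P0], so [phi0] matters only there. As the sets [L i] are disjoint,
   [pick] finds the only star at [v]. *)
pose phi0 w : 'I_s + 'I_t := inl (u (rt w)).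
pose tau0 (x : 'I_s + 'I_t) := if x is inr v then omap r [pick i | v \in L i] else None.
have emb0 : embedded r u rt par set0 P0 phi0 tau0 R0 B0.
  have [u' uK u'K] := injF_bij u_inj.
  split=> //.
  - by move=> w; rewrite inE.
  - by move=> w nw _; rewrite inE.
  - by move=> v w; rewrite !in_setC => /rootP -> /rootP -> [/u_inj]; rewrite !rtr => ->.
  - by move=> i; rewrite /phi0 rtr.
  - by move=> w nw; rewrite inE nw.
  - move=> x e Ux Re xe; have e2 : #|e| = 2 by case/setUP: Re => [/R2|/B2].
    have rN i : r i \notin P0 by rewrite inE /nonroot rtr eqxx.
    case: x Ux xe => [i|v] Ux xe.
      case/negP: Ux; have -> : inl i = phi0 (r (u' i)) by rewrite /phi0 rtr u'K.
      by apply: imset_f; rewrite inE rN.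
    have [y [yv Ee]] : exists y, y != inr v /\ e = [set y; inr v].
      have /eqP/cards2P [a [b [ab Eab]]] := e2; move: xe; rewrite Eab => /set2P [] ->.
        by exists b; rewrite eq_sym ab setUC.
      by exists a.
    (* Edges inside V are free and none from U to V is red, so a coloured edge at [v] is a star
       edge. *)
    case: y yv Ee => [j|w] _ Ee; last by have := VV w v; rewrite -Ee Re.
    rewrite -(u'K j) in Ee; set i := u' j in Ee.
    have vL : v \in L i by move: Re; rewrite Ee inE (negbTE (UVred _ _)) UVblue.
    exists (r i); split=> //; last by rewrite /phi0 rtr.
    rewrite /tau0; case: pickP => [k vk|/(_ i)]; last by rewrite vL.
    have [->//|/Ldisj/disjoint_setI0/setP/(_ v)] := eqVneq k i.
    by rewrite !inE vk vL.
    by rewrite /childless /nonroot rtr eqxx.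
  - by move=> e /setUP [/R2|/B2] e2; rewrite -card_gt0 e2.
  - by move=> g; rewrite inE.
have q0q : #|touched P0 phi0 tau0| <= q.
  have sub : touched P0 phi0 tau0 \subset inr @: \bigcup_i L i.
    apply/subsetP => -[i|v]; rewrite inE /tau0 ?andbF // => /andP [_].
    by case: pickP => [i vi _|//]; apply/imset_f/bigcupP; exists i.
  apply: leq_trans (subset_leq_card sub) _; apply: leq_trans (leq_imset_card _ _) _.
  rewrite -Lq; elim/big_rec2: _ => [|i n A _ IH]; first by rewrite cards0.
  by apply: leq_trans (leq_card_setU _ _) _; rewrite leq_add2l.
have st0 : state r u rt par set0 P0 #|touched P0 phi0 tau0| R0 B0.
  by exists phi0, tau0.
have bal0 c : c <= 2 -> balanced rt (t - #|E|) c P0 #|touched P0 phi0 tau0|.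
  (* Initially n = t, and the strict inequality 3 e(T_i) < t - q gives every tree the tighter bound
     with slack up to 2. *)
  move=> c2; have H i : 3 * pending rt P0 i + c + #|touched P0 phi0 tau0| <=
      #|P0| + (t - #|E|) + 1.
    by rewrite pendE -cardE; have [_] := size_tree i; lia.
  by split=> [i|i j _]; [apply: leq_trans (H i) _; lia | left].
rewrite cardE.
have [E0|Elt] := posnP (t - #|E|).
  exact: (force_spanning rtr parP u_inj cardW goalP E0 st0 (bal0 2 isT)).
apply: (wc_forceW (leqnSn _)).
exact: (force_spare rtr parP u_inj cardW goalP Elt st0 (bal0 1 isT)).
Qed.
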